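(* Fix any fractional schedule $x_1,\dots,x_T$ (each $x_t\in\mathbb R^K$, $x_{t,i}\ge0$, $\sum_ix_{t,i}=1$). For any pull sequence $A_1,\dots,A_T\in[K]$, the following hold. (i) The exposure error of each arm is exactly the corresponding coordinate of the discrepancy vector: $N_i(T)-S_i(T)=D_{T,i}$. Hence, if $S_i(T)\ge m+B$ for every $i$ and $\|D_T\|_\infty\le B$, then the integral pull sequence is $m$-fair. (ii) The reward gap relative to the fractional schedule is a weighted discrepancy: $$\sum_{t=1}^T\mu^\top x_t-\sum_{t=1}^T\mu_{A_t}=-\mu^\top D_T.$$ (iii) Therefore, minimizing reward loss subject to a fairness floor is a constrained discrepancy-minimization problem: one chooses one vector from $\{e_1-x_t,\dots,e_K-x_t\}$ at each time $t$, controls the terminal $\ell_\infty$ discrepancy $\|D_T\|_\infty$ for fairness, and controls the weighted discrepancy $-\mu^\top D_T$ for regret.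
   Context: There are $K$ arms with mean vector $\mu=(\mu_1,\dots,\mu_K)\in[0,1]^K$ and horizon $T$. $e_i$ is the $i$-th standard basis vector of $\mathbb R^K$. $N_i(T)=\#\{t\le T:A_t=i\}$, $N(T)=(N_i(T))_i$; $S_i(T)=\sum_{t=1}^Tx_{t,i}$, $S(T)=(S_i(T))_i$; the discrepancy vector is $D_T=\sum_{t=1}^T(e_{A_t}-x_t)$. For an integer $m\ge0$, a pull sequence is $m$-fair if $N_i(T)\ge m$ for every $i$. $B\ge0$ is any real number. *)

(* Defs.v *)
From mathcomp Require Import all_boot all_order all_algebra.
From mathcomp Require Import boolp classical_sets reals.
From mathcomp Require Import topology normedtype.

Set Implicit Arguments.
Unset Strict Implicit.
Unset Printing Implicit Defensive.

Import Order.TTheory GRing.Theory Num.Theory.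
Import numFieldNormedType.Exports.

Local Open Scope classical_set_scope.
Local Open Scope ring_scope.

(* Arms are indexed by 'I_K and rounds by 'I_T, i.e. shifted down by one from
   {1, ..., K} and {1, ..., T}.  Vectors of R^K are columns. *)

Definition basis_vec (R : realType) (K : nat) (i : 'I_K) : 'cV[R]_K :=
  delta_mx i 0.

Definition dot (R : realType) (K : nat) (u v : 'cV[R]_K) : R :=
  (u^T *m v) 0 0.

Definition fractional_schedule (R : realType) (K T : nat)
    (x : 'I_T -> 'cV[R]_K) : Prop :=
  forall t, (forall i, 0 <= x t i 0) /\ \sum_(i < K) x t i 0 = 1.

(* Finite functions, so that equality of pull sequences is pointwise equality
   without function extensionality. *)
Definition pull_sequence (K T : nat) : Type := {ffun 'I_T -> 'I_K}.

Definition pulls (K T : nat) (A : pull_sequence K T) (i : 'I_K) : nat :=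
  #|[pred t | A t == i]|.

Definition frac_exposure (R : realType) (K T : nat) (x : 'I_T -> 'cV[R]_K)
    (i : 'I_K) : R :=
  \sum_(t < T) x t i 0.

Definition discrepancy (R : realType) (K T : nat) (x : 'I_T -> 'cV[R]_K)
    (A : pull_sequence K T) : 'cV[R]_K :=
  \sum_(t < T) (basis_vec R (A t) - x t).

Definition fair (K T m : nat) (A : pull_sequence K T) : Prop :=
  forall i, (m <= pulls A i)%N.

Definition reward_gap (R : realType) (K T : nat) (mu : 'cV[R]_K)
    (x : 'I_T -> 'cV[R]_K) (A : pull_sequence K T) : R :=
  \sum_(t < T) dot mu (x t) - \sum_(t < T) mu (A t) 0.

Definition minimizes (R : realType) (X : Type) (F : set X) (f : X -> R)
    (a : X) : Prop :=
  F a /\ forall b, F b -> f a <= f b.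

Definition step_choice (R : realType) (K T : nat) (x : 'I_T -> 'cV[R]_K)
    (v : {ffun 'I_T -> 'cV[R]_K}) : Prop :=
  forall t, range (fun i : 'I_K => basis_vec R i - x t) (v t).

Definition steps (R : realType) (K T : nat) (x : 'I_T -> 'cV[R]_K)
    (A : pull_sequence K T) : {ffun 'I_T -> 'cV[R]_K} :=
  [ffun t => basis_vec R (A t) - x t].

(* The vector-choice problem refers to no pull sequence: pick one vector of
   {e_1 - x_t, ..., e_K - x_t} per round, with terminal sum in [C], and minimize
   the weighted discrepancy - mu^T (terminal sum). *)
Definition solves_discrepancy_problem (R : realType) (K T : nat)
    (mu : 'cV[R]_K) (x : 'I_T -> 'cV[R]_K) (C : set 'cV[R]_K)
    (v : {ffun 'I_T -> 'cV[R]_K}) : Prop :=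
  minimizes
    [set w : {ffun 'I_T -> 'cV[R]_K} | step_choice x w /\ C (\sum_t w t)]
    (fun w : {ffun 'I_T -> 'cV[R]_K} => - dot mu (\sum_t w t)) v.

(* Main.v *)
Require Import Defs.
From mathcomp Require Import all_boot all_order all_algebra.
From mathcomp Require Import boolp classical_sets reals.
From mathcomp Require Import topology normedtype.

Set Implicit Arguments.
Unset Strict Implicit.
Unset Printing Implicit Defensive.

Import Order.TTheory GRing.Theory Num.Theory.
Import numFieldNormedType.Exports.

Local Open Scope classical_set_scope.
Local Open Scope ring_scope.

(** Coordinate i of e_{A_t} is the indicator of A_t = i, and mu^T e_{A_t} = mu_{A_t}. Summing over t
    gives the two identities by linearity ([exposure_error], [reward_gapE]). For the reformulation,
    [steps x] is a bijection from pull sequences onto vector choices ([steps_inj], [step_choiceP])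
    that turns the terminal sum into D_T. The objective and both kinds of constraint depend on the
    pull sequence through D_T alone, so minimizers correspond ([minimizes_steps]). *)

Lemma dot_basis_vec (R : realType) (K : nat) (u : 'cV[R]_K) (i : 'I_K) :
  dot u (basis_vec R i) = u i 0.
Proof. by rewrite /dot /basis_vec -colE !mxE. Qed.

Lemma dotB (R : realType) (K : nat) (u v w : 'cV[R]_K) :
  dot u (v - w) = dot u v - dot u w.
Proof. by rewrite /dot mulmxBr !mxE. Qed.

Lemma dot_sum (R : realType) (K T : nat) (u : 'cV[R]_K)
    (v : 'I_T -> 'cV[R]_K) :
  dot u (\sum_t v t) = \sum_t dot u (v t).
Proof. by rewrite /dot mulmx_sumr summxE. Qed.

Lemma basis_vec_inj (R : realType) (K : nat) :
  injective (@basis_vec R K).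
Proof.
move=> i j /matrixP /(_ i 0); rewrite !mxE !eqxx /= andbT.
by case: eqVneq => // _ /eqP; rewrite oner_eq0.
Qed.

(** Translation by x_t is injective in each round, and distinct arms have distinct basis vectors. *)
Lemma steps_inj (R : realType) (K T : nat) (x : 'I_T -> 'cV[R]_K) :
  injective (@steps R K T x).
Proof.
move=> A A' /ffunP eqAA'; apply/ffunP => t.
by move: (eqAA' t); rewrite !ffunE => /addIr /basis_vec_inj.
Qed.

Lemma step_choiceP (R : realType) (K T : nat) (x : 'I_T -> 'cV[R]_K)
    (v : {ffun 'I_T -> 'cV[R]_K}) :
  step_choice x v <-> exists A : pull_sequence K T, steps x A = v.
Proof.
split=> [vx | [A <-] t]; last by exists (A t); rewrite ?ffunE.
(* Each vector of v comes from some arm; choice collects one arm per round into a pull sequence. *)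
have /choice [f fP] : forall t, exists i : 'I_K, basis_vec R i - x t = v t.
  by move=> t; have [i _ <-] := vx t; exists i.
by exists (finfun f); apply/ffunP => t; rewrite !ffunE.
Qed.

Lemma sum_steps (R : realType) (K T : nat) (x : 'I_T -> 'cV[R]_K)
    (A : pull_sequence K T) :
  \sum_t steps x A t = discrepancy x A.
Proof. by apply: eq_bigr => t _; rewrite ffunE. Qed.

Lemma exposure_error (R : realType) (K T : nat) (x : 'I_T -> 'cV[R]_K)
    (A : pull_sequence K T) (i : 'I_K) :
  (pulls A i)%:R - frac_exposure x i = discrepancy x A i 0.
Proof.
(* The pull count becomes a sum of indicators over all rounds, to be compared term by term. *)
rewrite /discrepancy summxE /frac_exposure /pulls -sum1_card natr_sum big_mkcond.
rewrite -sumrB; apply: eq_bigr => t _.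
by rewrite !mxE inE eqxx andbT eq_sym; case: eqP.
Qed.

Lemma reward_gapE (R : realType) (K T : nat) (mu : 'cV[R]_K)
    (x : 'I_T -> 'cV[R]_K) (A : pull_sequence K T) :
  reward_gap mu x A = - dot mu (discrepancy x A).
Proof.
rewrite /reward_gap /discrepancy dot_sum -sumrB -sumrN; apply: eq_bigr => t _.
by rewrite dotB dot_basis_vec opprB.
Qed.

(** Subtracting S_i from N_i >= m expresses the floor as a one-sided constraint on D_T, the form
    that [minimizes_steps] requires. *)
Lemma fairE (R : realType) (K T m : nat) (x : 'I_T -> 'cV[R]_K)
    (A : pull_sequence K T) :
  fair m A <->
  forall i, m%:R - frac_exposure x i <= discrepancy x A i 0.
Proof.
by split=> fA i; have := fA i; rewrite -exposure_error lerD2r ler_nat.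
Qed.

(** N_i = S_i + D_{T,i} >= (m + B) - B = m, since the sup norm dominates every coordinate. *)
Lemma fair_of_discrepancy_le (R : realType) (K T m : nat) (B : R)
    (x : 'I_T -> 'cV[R]_K) (A : pull_sequence K T) :
  (forall i, m%:R + B <= frac_exposure x i) ->
  `|discrepancy x A| <= B -> fair m A.
Proof.
move=> mBx DB; apply/(fairE m x) => i.
have : `|discrepancy x A i 0| <= B.
  (* The norm is a maximum over index pairs; coordinate i of a column is the entry (i, 0). *)
  by apply: le_trans DB; rewrite [leRHS]mx_normrE;
    exact: (le_bigmax _ (fun ij => `|discrepancy x A ij.1 ij.2|) (i, 0)).
rewrite ler_norml => /andP[NBD _]; apply: le_trans NBD.
by rewrite lerBlDr addrC lerBrDr.
Qed.

(** Transfer principle: if F is the preimage of C under A' |-> D_T, then [steps x] maps F onto the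
    feasible vector choices and preserves the objective by [reward_gapE]. *)
Lemma minimizes_steps (R : realType) (K T : nat) (mu : 'cV[R]_K)
    (x : 'I_T -> 'cV[R]_K) (F : set (pull_sequence K T)) (C : set 'cV[R]_K)
    (A : pull_sequence K T) :
  (forall A', F A' <-> C (discrepancy x A')) ->
  minimizes F (reward_gap mu x) A <->
  solves_discrepancy_problem mu x C (steps x A).
Proof.
move=> FC; split=> [[FA minA] | [[_ CA] minA]].
  split=> [|_ [/step_choiceP[A' <-]]] /=.
    by rewrite sum_steps; split; [apply/step_choiceP; exists A | exact/FC].
  by rewrite !sum_steps -!reward_gapE => /FC; exact: minA.
split=> [|A' /FC CA']; first by apply/FC; rewrite -sum_steps.
rewrite !reward_gapE -!sum_steps; apply: minA.
by rewrite /= sum_steps; split=> //; apply/step_choiceP; exists A'.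
Qed.

(* On 'cV[R]_K the norm `| _ | is the sup norm. *)
Theorem proposition1 (R : realType) (K T : nat) (mu : 'cV[R]_K)
    (hmu : forall i, 0 <= mu i 0 <= 1)
    (x : 'I_T -> 'cV[R]_K) (hx : fractional_schedule x)
    (A : pull_sequence K T) :
  (* (i) *)
  ((forall i, (pulls A i)%:R - frac_exposure x i = discrepancy x A i 0) /\
   (forall (m : nat) (B : R), 0 <= B ->
      (forall i, m%:R + B <= frac_exposure x i) ->
      `|discrepancy x A| <= B -> fair m A)) /\
  (* (ii) *)
  \sum_(t < T) dot mu (x t) - \sum_(t < T) mu (A t) 0
    = - dot mu (discrepancy x A) /\
  (* (iii) *)
  ((* pull sequences are exactly the vector choices *)
   (forall v : {ffun 'I_T -> 'cV[R]_K},
      step_choice x v <-> exists! A' : pull_sequence K T, steps x A' = v) /\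
   (* the problem with the fairness floor itself *)
   (forall m : nat,
      minimizes [set A' | fair m A'] (reward_gap mu x) A <->
      solves_discrepancy_problem mu x
        [set D : 'cV[R]_K | forall i, m%:R - frac_exposure x i <= D i 0] (steps x A)) /\
   (* the problem with fairness controlled through the sup norm *)
   (forall B : R, 0 <= B ->
      (minimizes [set A' | `|discrepancy x A'| <= B] (reward_gap mu x) A <->
       solves_discrepancy_problem mu x [set D : 'cV[R]_K | `|D| <= B] (steps x A)) /\
      (forall m : nat, (forall i, m%:R + B <= frac_exposure x i) ->
         forall v : {ffun 'I_T -> 'cV[R]_K},
           step_choice x v -> `|\sum_t v t| <= B ->
           exists A' : pull_sequence K T,
             [/\ steps x A' = v, fair m A' &
                 reward_gap mu x A' = - dot mu (\sum_t v t)]))).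
Proof.
split; first by split=> [|m B _]; [exact: exposure_error |
  exact: fair_of_discrepancy_le].
split; first exact: reward_gapE.
split=> [v|].
  split=> [/step_choiceP[A' <-] | [A' [A'v _]]]; last by
    apply/step_choiceP; exists A'.
  by exists A'; split=> // A'' /steps_inj.
split=> [m | B _]; first by apply: minimizes_steps => A'; exact: fairE.
(* The sup-norm ball pulls back along [discrepancy x] to the feasible set by definition. *)
split=> [|m mBx v /step_choiceP[A' <-]]; first exact: minimizes_steps.
rewrite sum_steps => DB; exists A'; split=> //; last exact: reward_gapE.
exact: fair_of_discrepancy_le DB.
Qed.
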